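(* Let $M\subseteq\mathcal A^{\mathbb Z}$ be a minimal shift space that is not the orbit of a periodic point, and let $m\in M$. Then the shift space $X(m)$ is synchronizing. Furthermore, the set of non-synchronizing points in $X(m)$ is exactly $M$.
   Context: A shift space is a closed, shift-invariant subset $X$ of $\mathcal B^{\mathbb Z}$ for a finite alphabet $\mathcal B$, with shift map $\sigma(x)_i=x_{i+1}$. $\mathcal L(X)$ is the set of finite words (including the empty word) occurring in elements of $X$. $X$ is minimal if its only closed $\sigma$-invariant subsets are $\emptyset$ and $X$. $X$ is irreducible if for all $w,v\in\mathcal L(X)$ there is $u\in\mathcal L(X)$ with $wuv\in\mathcal L(X)$. A word $w\in\mathcal L(X)$ is synchronizing if whenever $u,v\in\mathcal L(X)$ satisfy $uw\in\mathcal L(X)$ and $wv\in\mathcal L(X)$, then $uwv\in\mathcal L(X)$. A point of $X$ is synchronizing if it contains a synchronizing word. $X$ is synchronizing if it is irreducible and contains a synchronizing point. Construction of $X(m)$: let $\mathcal A$ be a finite alphabet, $\widetilde{\mathcal A}=\mathcal A\sqcup\{e\}$ with $e$ a new symbol. Let $G(m)$ be the infinite labelled directed graph with vertices $u_0,u_1,u_2,\dots$, an edge from $u_i$ to $u_{i+1}$ labelled $m_i$ for each $i\ge0$, and an edge from $u_i$ to $u_0$ labelled $e$ for each $i\ge0$ (in particular a loop labelled $e$ at $u_0$). $X(m)\subseteq\widetilde{\mathcal A}^{\mathbb Z}$ is the closure of the set of label sequences of bi-infinite paths in $G(m)$. *)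

(* Defs.v *)
From HB Require Import structures.
From mathcomp Require Import all_boot all_order all_algebra.
From mathcomp Require Import all_classical all_reals all_analysis.

Set Implicit Arguments.
Unset Strict Implicit.
Unset Printing Implicit Defensive.

Import Order.TTheory GRing.Theory Num.Theory.
Local Open Scope classical_set_scope.
Local Open Scope ring_scope.

Definition full_shift (B : finType) := {ptws int -> discrete_topology B}.

Definition shift_map (B : finType) (x : full_shift B) : full_shift B :=
  fun i => x (i + 1).

(* Invariance is two-sided, sigma(X) = X. *)
Definition shift_invariant (B : finType) (X : set (full_shift B)) : Prop :=
  (@shift_map B) @` X = X.

Definition shift_space (B : finType) (X : set (full_shift B)) : Prop :=
  closed X /\ shift_invariant X.

Definition minimal_shift (B : finType) (X : set (full_shift B)) : Prop :=
  forall Y : set (full_shift B), Y `<=` X -> closed Y -> shift_invariant Y ->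
    Y = set0 \/ Y = X.

Definition periodic_point (B : finType) (x : full_shift B) : Prop :=
  exists2 n : nat, (0 < n)%N & iter n (@shift_map B) x = x.

(* The two-sided orbit {sigma^n(x) : n in Z}. *)
Definition shift_orbit (B : finType) (x : full_shift B) : set (full_shift B) :=
  [set y | exists n : int, forall i : int, y i = x (i + n)].

Definition occurs_in (B : finType) (w : seq B) (x : full_shift B) : Prop :=
  exists i : int, w = mkseq (fun k => x (i + k%:Z)) (size w).

Definition language (B : finType) (X : set (full_shift B)) : set (seq B) :=
  [set w | exists2 x, X x & occurs_in w x].

Definition irreducible_shift (B : finType) (X : set (full_shift B)) : Prop :=
  forall w v : seq B, language X w -> language X v ->
    exists2 u, language X u & language X (w ++ u ++ v).

Definition synchronizing_word (B : finType) (X : set (full_shift B))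
    (w : seq B) : Prop :=
  language X w /\
  forall u v : seq B, language X u -> language X v ->
    language X (u ++ w) -> language X (w ++ v) -> language X (u ++ w ++ v).

Definition synchronizing_point (B : finType) (X : set (full_shift B))
    (x : full_shift B) : Prop :=
  X x /\ exists2 w, synchronizing_word X w & occurs_in w x.

Definition synchronizing_shift (B : finType) (X : set (full_shift B)) : Prop :=
  irreducible_shift X /\ exists x, synchronizing_point X x.

Definition nonsynchronizing_points (B : finType) (X : set (full_shift B)) :
    set (full_shift B) :=
  [set x | X x /\ ~ synchronizing_point X x].

Record labelled_graph (L : Type) := LabelledGraph {
  vertex : Type;
  edge : Type;
  source : edge -> vertex;
  target : edge -> vertex;
  label : edge -> L }.

Definition biinfinite_path (L : Type) (G : labelled_graph L)
    (p : int -> edge G) : Prop :=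
  forall i : int, target (p i) = source (p (i + 1)).

Definition path_labels (B : finType) (G : labelled_graph B) :
    set (full_shift B) :=
  [set x | exists2 p : int -> edge G, biinfinite_path p &
             forall i : int, x i = label (p i)].

(* The alphabet A + {e} is [option A], with e := None. *)

(* [Forward i] is the edge from u_i to u_{i+1}, [Return i] the edge from u_i
   to u_0. *)
Inductive Gm_edge : Type := Forward of nat | Return of nat.

Definition Gm (A : finType) (m : full_shift A) : labelled_graph (option A) :=
  {| vertex := nat;
     edge := Gm_edge;
     source := fun a => match a with Forward i => i | Return i => i end;
     target := fun a => match a with Forward i => i.+1 | Return _ => 0%N end;
     label := fun a =>
       match a with Forward i => Some (m i%:Z) | Return _ => None end |}.

Definition Xm (A : finType) (m : full_shift A) : set (full_shift (option A)) :=
  closure (path_labels (Gm m)).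

Definition extend_alphabet (A : finType) (x : full_shift A) :
    full_shift (option A) :=
  fun i => Some (x i).

(* Main.v *)
(** A path of G(m) is reset to u_0 by each edge labelled e, so the word e is
    synchronizing in X(m). A point of X(m) without e has all its windows inside
    m_0 m_1 ..., hence lies in M; conversely M is the omega-limit set of m by
    minimality, so M is contained in X(m) and each word w of M occurs in m at
    arbitrarily large positions. Reading e m_0 ... m_{k-1} w with w occurring
    at position k forces the path to stay on the ray, so if w were synchronizing
    then all occurrences of w in m would have the same right continuation. Then
    m would be eventually periodic and M would be a periodic orbit. *)
Require Import Defs.
From mathcomp Require Import all_boot all_order all_algebra.
From mathcomp Require Import all_classical all_reals all_analysis.
From mathcomp Require Import zify.

Set Implicit Arguments.
Unset Strict Implicit.
Unset Printing Implicit Defensive.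

Import Order.TTheory GRing.Theory Num.Theory.
Local Open Scope classical_set_scope.
Local Open Scope ring_scope.

(** * Cylinders, closure and compactness in the full shift *)

Lemma nbhs_cylinder (B : finType) (x : full_shift B) (i : int) (n : nat) :
  nbhs x [set y : full_shift B |
           forall k, (k < n)%N -> y (i + k%:Z) = x (i + k%:Z)].
Proof.
elim: n => [|n IH]; first by apply: filterS (@filterT _ _ _) => y _ k.
have px : nbhs x [set y : full_shift B | y (i + n%:Z) = x (i + n%:Z)].
  exact: (@proj_continuous int (fun=> discrete_topology B) (i + n%:Z) x _
           (@discrete_set1 (discrete_topology B) (x (i + n%:Z)))).
apply: filterS (filterI px IH) => y [/= yn yk] k.
by rewrite ltnS leq_eqVlt => /predU1P[->//|/yk].
Qed.

Lemma cvg_full_shift (B : finType) (T : Type) (F : set_system T)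
    (f : T -> full_shift B) (x : full_shift B) : Filter F ->
  (forall i : int, \forall t \near F, f t i = x i) -> f t @[t --> F] --> x.
Proof.
move=> FF fx; apply/cvg_sup => i; apply/cvg_image.
  by rewrite eqEsubset; split=> b // _; exists (fun=> b).
move=> V /(@principal_filterP _ (x i)) Vx; exists [set y | V (y i)].
  by apply: filterS (fx i) => t /= ->.
by rewrite eqEsubset; split=> [_ [y Vy <-]//|b Vb]; exists (fun=> b).
Qed.

Lemma closure_fullP (B : finType) (S : set (full_shift B)) (x : full_shift B) :
  closure S x <-> forall (i : int) n, exists2 y, S y &
    forall k, (k < n)%N -> y (i + k%:Z) = x (i + k%:Z).
Proof.
split=> [Sx i n|Sx].
  by have [y [Sy yx]] := Sx _ (nbhs_cylinder x i n); exists y.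
(* The windows from [-n] to [n - 1] exhaust the integers, so the chosen points converge to [x]
   coordinatewise. *)
have /choice[y yP] (n : nat) : exists y, S y /\
    forall k, (k < n.*2)%N -> y (- n%:Z + k%:Z) = x (- n%:Z + k%:Z).
  have [y Sy yx] := Sx (- n%:Z) n.*2.
  by exists y; split=> // k; exact: yx.
apply: (@closed_cvg _ (full_shift B) (nbhs \oo) _ y (closure S) _ _ x).
- exact: closed_closure.
- by apply: nearW => n; apply: subset_closure; case: (yP n).
- apply: cvg_full_shift => i; exists (`|i|%N.+1) => // n /= ltin.
  have -> : i = - n%:Z + (absz (i + n%:Z))%:Z by lia.
  by case: (yP n) => _; apply; lia.
Qed.

Lemma closed_fullP (B : finType) (S : set (full_shift B)) (x : full_shift B) :
  closed S -> (forall (i : int) n, exists2 y, S y &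
    forall k, (k < n)%N -> y (i + k%:Z) = x (i + k%:Z)) -> S x.
Proof. by move=> /closure_id {2}-> Sx; apply/closure_fullP. Qed.

(** By Tychonoff's theorem the sequence [f] has a cluster point [z]. *)
Lemma full_shift_cluster (B : finType) (f : nat -> full_shift B) :
  exists z : full_shift B, forall (i : int) (n N : nat), exists2 k, (N <= k)%N &
    forall t, (t < n)%N -> f k (i + t%:Z) = z (i + t%:Z).
Proof.
have cB : compact [set: discrete_topology B].
  by apply: finite_compact; exact: finite_finset.
have [|z [_ zf]] := @tychonoff int (fun=> discrete_topology B) (fun=> setT)
    (fun=> cB) (f k @[k --> \oo]) _ _.
  by exists 0%N.
exists z => i n N.
have [|_ [[k Nk <-] fk]] := zf (f @` [set k | (N <= k)%N]) _ _
    (nbhs_cylinder z i n); last by exists k.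
by exists N => // k Nk; exists k.
Qed.

(** * Shift invariance and recurrence in minimal shifts *)

Lemma shift_invariantP (B : finType) (X : set (full_shift B)) :
  shift_invariant X <->
  forall x (n : int), X x -> X (fun i => x (i + n)).
Proof.
split=> [XE|Xn].
  have S1 x : X x -> X (fun i => x (i + 1)).
    by move=> Xx; rewrite -XE; exists x.
  have SN1 x : X x -> X (fun i => x (i - 1)).
    rewrite -{1}XE => -[y Xy <-]; congr X: Xy; apply/funext => i.
    by rewrite /shift_map subrK.
  move=> x [n|n] Xx; elim: n => [|n IH].
  - by congr X: Xx; apply/funext => i; rewrite addr0.
  - congr X: (S1 _ IH); apply/funext => i; congr x; lia.
  - congr X: (SN1 _ Xx); apply/funext => i; congr x; lia.
  - congr X: (SN1 _ IH); apply/funext => i; congr x; lia.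
rewrite /shift_invariant eqEsubset; split=> [_ [x Xx <-]|x Xx].
  exact: (Xn x 1).
exists (fun i => x (i + -1)); first exact: Xn.
by apply/funext => i; rewrite /shift_map addrK.
Qed.

Lemma minimal_recurrence (A : finType) (M : set (full_shift A))
    (m y : full_shift A) : shift_space M -> minimal_shift M -> M m -> M y ->
  forall (i : int) (n N : nat), exists2 k, (N <= k)%N &
    forall t, (t < n)%N -> m (k + t)%N = y (i + t%:Z).
Proof.
move=> [clM /shift_invariantP invM] minM Mm My.
(* The omega-limit set of [m]: closed, invariant and contained in [M], so it is empty or [M].
   Compactness excludes the empty case. *)
pose W : set (full_shift A) := [set z | forall (i : int) (n N : nat),
  exists2 k, (N <= k)%N & forall t, (t < n)%N -> m (k + t)%N = z (i + t%:Z)].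
have [|||W0|WM] := minM W; last by move: My; rewrite -WM.
- move=> z Wz; apply: closed_fullP => // i n; have [k _ km] := Wz i n 0%N.
  exists (fun j => m (j + (k%:Z - i))); first exact: invM.
  by move=> t /km <-; congr m; lia.
- move=> z /closure_fullP clz i n N; have [z' Wz' zz'] := clz i n.
  by have [k Nk km] := Wz' i n N; exists k => // t tn; rewrite km // zz'.
- apply/shift_invariantP => z j Wz i n N; have [k Nk km] := Wz (i + j) n N.
  by exists k => // t /km ->; congr z; lia.
have [z zm] := full_shift_cluster (fun k i => m (k%:Z + i)).
suff : W z by rewrite W0.
(* The window is read in [m] at [k + i]; adding [absz i] to the bound makes this position at least
   [N], even for negative [i]. *)
move=> i n N; have [k Nk km] := zm i n (N + absz i)%N.
exists (absz (k%:Z + i)); first lia.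
by move=> t /km <-; congr m; lia.
Qed.

(** * Periodic points and their orbits *)

Lemma periodic_modz (T : Type) (z : int -> T) (p : nat) (i : int) :
  (forall j : int, z (j + p%:Z) = z j) -> z i = z (i %% p%:Z)%Z.
Proof.
move=> zp; rewrite {1}(divz_eq i p); move: (i %/ p)%Z (i %% p)%Z => [q|q] r.
  elim: q => [|q IH]; first by congr z; lia.
  by rewrite -IH -(zp (q%:Z * p%:Z + r)); congr z; lia.
elim: q => [|q IH]; first by rewrite -(zp (_ + _)); congr z; lia.
by rewrite -IH -(zp (Negz q.+1 * _ + _)); congr z; lia.
Qed.

Lemma iter_shift_map (B : finType) (n : nat) (x : full_shift B) (i : int) :
  iter n (@shift_map B) x i = x (i + n%:Z).
Proof.
elim: n i => [|n IH] i; first by rewrite addr0.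
by rewrite iterS /shift_map IH; congr x; lia.
Qed.

(** A limit [z] of translates of [y] inherits the period [p] from windows of length [p + 1].
    Agreement with one translate on a window of length [p] then extends to all coordinates. *)
Lemma closed_orbit_periodic (B : finType) (y : full_shift B) :
  periodic_point y -> closed (shift_orbit y).
Proof.
move=> [p p0 py] z /closure_fullP clz.
have yp (i : int) : y (i + p%:Z) = y i by rewrite -{2}py iter_shift_map.
have zp (i : int) : z (i + p%:Z) = z i.
  have [x [n xy] xz] := clz i p.+1.
  rewrite -[i in RHS]addr0 -(xz 0%N) // -xz // !xy addr0.
  by rewrite -[in RHS]yp; congr y; lia.
have [x [n xy] xz] := clz 0 p; exists n => i.
rewrite (periodic_modz _ zp) (periodic_modz _ yp) -modzDml.
have /gez0_abs <- : 0 <= (i %% p%:Z)%Z by apply: modz_ge0; lia.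
rewrite -(periodic_modz _ yp) -xy -[X in z X = _]add0r -xz ?add0r //.
rewrite -ltz_nat gez0_abs ?modz_ge0 ?ltz_pmod //; lia.
Qed.

Lemma shift_orbit_invariant (B : finType) (y : full_shift B) :
  shift_invariant (shift_orbit y).
Proof.
apply/shift_invariantP => z n [k zk]; exists (n + k) => i.
by rewrite zk; congr y; lia.
Qed.

Lemma eventually_periodic_minimal (A : finType) (M : set (full_shift A))
    (m : full_shift A) (k p : nat) :
  shift_space M -> minimal_shift M -> M m -> (0 < p)%N ->
  (forall n, m (k + p + n)%N = m (k + n)%N) ->
  exists x, periodic_point x /\ M = shift_orbit x.
Proof.
move=> [clM /shift_invariantP invM] minM Mm p0 mp.
(* The two-sided periodic extension of the tail of [m] from [k] on. Its orbit is closed, invariant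
   and nonempty, so it equals [M] once it lies in [M]. *)
pose y : full_shift A := fun i => m (k + absz (i %% p%:Z)%Z)%N.
have yE (n : nat) : y n%:Z = m (k + n)%N.
  rewrite /y modz_nat /=; rewrite [in RHS](divn_eq n p).
  elim: (n %/ p)%N => [|q IH] //; rewrite IH -mp; congr m; lia.
have yp (i : int) : y (i + p%:Z) = y i by rewrite /y modzDr.
have py : periodic_point y.
  by exists p => //; apply/funext => i; rewrite iter_shift_map.
exists y; split=> //.
have [z [n zn]|||W0|//] := minM (shift_orbit y).
- apply: closed_fullP => // i l.
  (* The phase at which the window of [z] starts: the same window occurs in [m] at [k + r]. *)
  pose r := (absz ((i + n) %% p%:Z)%Z).
  exists (fun j => m (j + ((k + r)%N%:Z - i))); first exact: invM.
  move=> t _; rewrite zn.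
  have -> : i + t%:Z + n = i + n + t%:Z by lia.
  rewrite (periodic_modz _ yp) -modzDml -(periodic_modz _ yp).
  have -> : ((i + n) %% p)%Z + t = (r + t)%N%:Z.
    by rewrite PoszD gez0_abs // modz_ge0 //; lia.
  by rewrite yE; congr m; lia.
- exact: closed_orbit_periodic.
- exact: shift_orbit_invariant.
have : shift_orbit y y by exists 0 => i; rewrite addr0.
by rewrite W0.
Qed.

(** * Paths of G(m) and points of X(m) *)

(** From a given vertex each letter labels at most one edge, so the end vertex of a walk is a fold
    over its labels. Whether the letter is allowed is tested in [walk]. *)
Definition walk_step (A : Type) (j : nat) (c : option A) : nat :=
  if c is Some _ then j.+1 else 0%N.

(* [walk m j w]: the word [w] labels a path of G(m) starting at u_j, whose end
   vertex is then u_i with [i = foldl walk_step j w]. *)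
Fixpoint walk (A : finType) (m : full_shift A) (j : nat)
    (w : seq (option A)) : Prop :=
  if w is c :: w' then
    (if c is Some a then a = m j%:Z else True) /\ walk m (walk_step j c) w'
  else True.

Lemma walk_cat (A : finType) (m : full_shift A) j (u v : seq (option A)) :
  walk m j (u ++ v) <-> walk m j u /\ walk m (foldl (@walk_step A) j u) v.
Proof. by elim: u j => [|c u IH] j /=; [tauto|rewrite IH; tauto]. Qed.

Lemma mkseq_recl (T : Type) (f : nat -> T) n :
  mkseq f n.+1 = f 0%N :: mkseq (fun k => f k.+1) n.
Proof. by rewrite /mkseq /= (iotaDl 1) -map_comp. Qed.

Lemma walk_mkseq (A : finType) (m : full_shift A) j (f : nat -> A) n :
  walk m j (mkseq (fun t => Some (f t)) n) <->
  forall t, (t < n)%N -> f t = m (j + t)%N.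
Proof.
elim: n j f => [|n IH] j f //; rewrite mkseq_recl /= IH; split.
  by move=> [f0 fS] [|t] tn; rewrite ?addn0 // fS // addSnnS.
move=> fm; split; first by rewrite fm // addn0.
by move=> t tn; rewrite fm // addSnnS.
Qed.

Lemma foldl_walk_step_mkseq (A : Type) j (f : nat -> A) n :
  foldl (@walk_step A) j (mkseq (fun t => Some (f t)) n) = (j + n)%N.
Proof.
elim: n j f => [|n IH] j f; first by rewrite addn0.
by rewrite mkseq_recl /= IH addSnnS.
Qed.

Lemma path_labels_walk (A : finType) (m : full_shift A) x (i : int) n :
  path_labels (Gm m) x ->
  exists j, walk m j (mkseq (fun k => x (i + k%:Z)) n).
Proof.
move=> [p pP xp]; exists (source (p i)); elim: n i => [|n IH] i //.
rewrite mkseq_recl /= addr0 xp; split; first by case: (p i).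
have -> : walk_step (source (p i)) (label (p i)) = source (p (i + 1)).
  by rewrite -pP; case: (p i).
congr (walk _ _ _): (IH (i + 1)); apply: eq_mkseq => k; congr x; lia.
Qed.

Lemma path_labels_shift (B : finType) (G : labelled_graph B) x (n : int) :
  path_labels G x -> path_labels G (fun i => x (i + n)).
Proof.
move=> [p pP xp]; exists (fun i => p (i + n)) => // i.
by rewrite pP; congr (source (p _)); lia.
Qed.

Lemma walk_path_labels (A : finType) (m : full_shift A) j w (i : int) :
  walk m j w -> exists2 x, path_labels (Gm m) x &
    forall k, (k < size w)%N -> x (i + k%:Z) = nth None w k.
Proof.
move=> wj.
(* Prefixing the labels from u_0 to u_j reduces to walks starting at u_0. *)
suff H0 w' : walk m 0 w' -> exists2 x, path_labels (Gm m) x &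
    forall k : nat, (k < size w')%N -> x k%:Z = nth None w' k.
  have [|x xG xw] := H0 (mkseq (fun t => Some (m t%:Z)) j ++ w).
    apply/walk_cat; rewrite foldl_walk_step_mkseq; split=> //.
    exact/walk_mkseq.
  exists (fun l => x (l + (j%:Z - i))); first exact: path_labels_shift.
  move=> k kw; have -> : i + k%:Z + (j%:Z - i) = (j + k)%N%:Z by lia.
  rewrite xw ?size_cat ?size_mkseq ?ltn_add2l // nth_cat size_mkseq.
  by rewrite ltnNge leq_addr /= addKn.
move=> {wj}w0; pose v n := foldl (@walk_step A) 0%N (mkseq (nth None w') n).
have vS n : v n.+1 = walk_step (v n) (nth None w' n).
  by rewrite /v mkseqS foldl_rcons.
(* The path stays on the loop at u_0 before time 0 and then follows [w']; past its end the default
   [None] keeps returning to u_0. *)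
pose p (l : int) := match l with
  | Posz n => if nth None w' n is Some _ then Forward (v n) else Return (v n)
  | Negz n => Return 0%N
  end.
have sp (n : nat) : source (p n%:Z : edge (Gm m)) = v n.
  by rewrite /p; case: (nth _ _ _).
exists (fun l => label (p l : edge (Gm m))).
  exists p => // -[n|[|n]].
  - have -> : Posz n + 1 = n.+1%:Z by lia.
    by rewrite sp vS /p; case: (nth _ _ _).
  - by have -> : Negz 0 + 1 = 0%N%:Z by []; rewrite sp.
  - by have -> : Negz n.+1 + 1 = Negz n by lia.
move=> k kw; have := w0; rewrite -{1}(cat_take_drop k w') (drop_nth None) //.
rewrite -(mkseq_nth None (take k w')) => /walk_cat [_ [+ _]].
have -> : mkseq (nth None (take k w')) (size (take k w')) =
    mkseq (nth None w') k.
  rewrite size_takel; last exact: ltnW.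
  apply/eq_in_map => t; rewrite mem_iota => /andP[_ tk].
  by rewrite nth_take.
by rewrite /= -/(v k); case: (nth _ _ _) => //= a ->.
Qed.

Lemma XmP (A : finType) (m : full_shift A) x : Xm m x <->
  forall (i : int) n, exists j, walk m j (mkseq (fun k => x (i + k%:Z)) n).
Proof.
rewrite /Xm closure_fullP; split=> [Xx i n|wx i n].
  have [y yG yx] := Xx i n; have [j wj] := path_labels_walk i n yG.
  exists j; congr (walk _ _ _): wj; apply/eq_in_map => t.
  by rewrite mem_iota => /andP[_ /yx].
have [j /(walk_path_labels i)[y yG]] := wx i n.
rewrite size_mkseq => yx; exists y => // k kn.
by rewrite yx // nth_mkseq.
Qed.

(** * The language of X(m) and its synchronizing words *)

Lemma language_XmP (A : finType) (m : full_shift A) w :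
  language (Xm m) w <-> exists j, walk m j w.
Proof.
split=> [[x /XmP Xx [i ->]]|[j /(walk_path_labels 0)[x xG xw]]].
  exact: Xx.
exists x; first exact: subset_closure.
exists 0; apply: (@eq_from_nth _ None); rewrite ?size_mkseq // => k kw.
by rewrite nth_mkseq // xw.
Qed.

Lemma Xm_shift_space (A : finType) (m : full_shift A) : shift_space (Xm m).
Proof.
split; first exact: closed_closure.
apply/shift_invariantP => x l /XmP Xx; apply/XmP => i n.
have [j wj] := Xx (i + l) n; exists j; congr (walk _ _ _): wj.
by apply: eq_mkseq => k; congr x; lia.
Qed.

Lemma Xm_irreducible (A : finType) (m : full_shift A) :
  irreducible_shift (Xm m).
Proof.
move=> w v /language_XmP[j wj] /language_XmP[k wk].
have sk : walk m 0 (mkseq (fun t => Some (m t%:Z)) k) by exact/walk_mkseq.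
(* After [w], the letter e returns to u_0, and the first [k] letters of the ray lead to u_k, where
   [v] can be read. *)
exists (None :: mkseq (fun t => Some (m t%:Z)) k); apply/language_XmP.
  by exists 0%N.
exists j; apply/walk_cat; split=> //=; split=> //.
by apply/walk_cat; rewrite foldl_walk_step_mkseq.
Qed.

(* Every edge labelled e ends at u_0, so the future after e does not depend on
   the past. *)
Lemma Xm_synchronizing_e (A : finType) (m : full_shift A) :
  synchronizing_word (Xm m) [:: None].
Proof.
split; first by apply/language_XmP; exists 0%N.
move=> u v _ _ /language_XmP[j /walk_cat[uj _]] /language_XmP[k /= [_ v0]].
by apply/language_XmP; exists j; apply/walk_cat.
Qed.

Lemma Xm_synchronizing (A : finType) (m : full_shift A) :
  synchronizing_shift (Xm m).
Proof.
split; first exact: Xm_irreducible.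
exists (fun=> None); split; last first.
  by exists [:: None]; [exact: Xm_synchronizing_e|exists 0].
apply/XmP => i n; exists 0%N; elim: n => // n IH.
by rewrite mkseq_recl.
Qed.

(* Reading [w] after e m_0 ... m_{k-1} leads to a determined vertex, so if [w]
   is synchronizing then any two of its occurrences in m have the same right
   continuation. *)
Lemma synchronizing_continuation (A : finType) (m : full_shift A)
    (f : nat -> A) (n k k' N : nat) :
  synchronizing_word (Xm m) (mkseq (fun t => Some (f t)) n) ->
  (forall t, (t < n)%N -> m (k + t)%N = f t) ->
  (forall t, (t < n)%N -> m (k' + t)%N = f t) ->
  m (k' + n + N)%N = m (k + n + N)%N.
Proof.
move=> [_ sync] km k'm; set w := mkseq _ n in sync.
have wj j : (forall t, (t < n)%N -> m (j + t)%N = f t) -> walk m j w.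
  by move=> jm; apply/walk_mkseq => t /jm.
pose u := None :: mkseq (fun t => Some (m t%:Z)) k.
(* The continuation of the occurrence at [k'], long enough to include offset [N]. *)
pose v := mkseq (fun t => Some (m (k' + n + t)%N)) N.+1.
have u0 : walk m 0 u by split=> //; exact/walk_mkseq.
have vk' : walk m (k' + n) v by exact/walk_mkseq.
have [||||j] := (language_XmP _ _).1 (sync u v _ _ _ _).
- by apply/language_XmP; exists 0%N.
- by apply/language_XmP; exists (k' + n)%N.
- apply/language_XmP; exists 0%N; apply/walk_cat; split=> //.
  by rewrite /= foldl_walk_step_mkseq; exact: wj.
- apply/language_XmP; exists k'; apply/walk_cat; split; first exact: wj.
  by rewrite foldl_walk_step_mkseq.
(* Whatever the start u_j, the letter e in [u] resets it, so [v] is read from vertex [k + n] and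
   spells the continuation of the occurrence at [k]. *)
move=> /walk_cat[_]; rewrite /= foldl_walk_step_mkseq => /walk_cat[_].
by rewrite foldl_walk_step_mkseq => /walk_mkseq; apply.
Qed.

Theorem theorem10p2 (A : finType) (M : set (full_shift A)) (m : full_shift A)
    (hM : shift_space M)
    (hmin : minimal_shift M)
    (hper : ~ exists x : full_shift A, periodic_point x /\ M = shift_orbit x)
    (hm : M m) :
  [/\ shift_space (Xm m),
      synchronizing_shift (Xm m)
    & nonsynchronizing_points (Xm m) = (@extend_alphabet A) @` M].
Proof.
split; [exact: Xm_shift_space|exact: Xm_synchronizing|].
rewrite eqEsubset; split=> [x [Xx nsx]|_ [y My <-]].
  have [clM /shift_invariantP invM] := hM.
  (* An e in [x] would make it synchronizing, so the default [m 0] is never taken. *)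
  have xE : x = extend_alphabet (fun i => odflt (m 0) (x i) : A).
    apply/funext => i; rewrite /extend_alphabet; case xi: (x i) => [//|].
    case: nsx; split=> //; exists [:: None]; first exact: Xm_synchronizing_e.
    by exists i; rewrite /= /mkseq /= addr0 xi.
  exists (fun i => odflt (m 0) (x i)) => //.
  apply: closed_fullP => // i n; move/XmP: Xx; rewrite xE.
  (* Without e a walk stays on the ray, so each window of [x] is a window of [m]. *)
  move=> /(_ i n)[j /walk_mkseq jm].
  exists (fun l => m (l + (j%:Z - i))); first exact: invM.
  by move=> k /jm /= ->; congr m; lia.
have rec := minimal_recurrence hM hmin hm My.
split.
  apply/XmP => i n; have [k _ km] := rec i n 0%N.
  by exists k; apply/walk_mkseq => t /km.
move=> [_ [w + [i wE]]]; rewrite wE; set n := size w => sync.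
(* Two occurrences with [k < k'] have equal continuations, which makes [k' - k] a period of [m] from
   [k + n] on. *)
have [k _ km] := rec i n 0%N; have [k' kk' k'm] := rec i n k.+1.
apply: hper; apply: (@eventually_periodic_minimal _ _ m (k + n) (k' - k)) => //.
  by rewrite subn_gt0.
move=> N; rewrite -(synchronizing_continuation N sync km k'm).
by congr m; lia.
Qed.
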